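(* Let $P$ be the transition matrix of a finite irreducible Markov chain with states $\{1,\dots,m\}$, stationary probability vector $\boldsymbol{\pi}^T=(\pi_1,\dots,\pi_m)$ and mean first passage times $\{m_{ij}\}$. Let $A^{\#}=[a^{\#}_{ij}]=[I-P+\boldsymbol{e}\boldsymbol{\pi}^T]^{-1}-\boldsymbol{e}\boldsymbol{\pi}^T$ be the group inverse of $I-P$, and let $\tau_j=\sum_{k=1}^m\pi_k m_{kj}$. Then $$a^{\#}_{ij}=\begin{cases}\pi_j(\tau_j-1-m_{ij}), & i\neq j,\\ \pi_j(\tau_j-1), & i=j.\end{cases}$$
   Context: $\boldsymbol{e}$ is the all-ones column vector; $\boldsymbol{\pi}^T$ is the unique stationary probability vector ($\boldsymbol{\pi}^TP=\boldsymbol{\pi}^T$, $\boldsymbol{\pi}^T\boldsymbol{e}=1$). $m_{ij}=E[T_{ij}\mid X_0=i]$, where $T_{ij}=\min\{n\ge 1: X_n=j\}$ given $X_0=i$ (first return when $i=j$); these are finite and $m_{jj}=1/\pi_j$. The group inverse of $A=I-P$ is the unique matrix $X$ with $AXA=A$, $XAX=X$, $AX=XA$; it is known to equal $[I-P+\boldsymbol{e}\boldsymbol{\pi}^T]^{-1}-\boldsymbol{e}\boldsymbol{\pi}^T$. *)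

(* Defs.v *)
From HB Require Import structures.
From mathcomp Require Import all_boot all_order all_algebra.
From mathcomp Require Import all_classical all_reals all_analysis.

Set Implicit Arguments.
Unset Strict Implicit.
Unset Printing Implicit Defensive.

Import Order.TTheory GRing.Theory Num.Theory.
Import numFieldNormedType.Exports.

Local Open Scope classical_set_scope.
Local Open Scope ring_scope.

(* The state space {1, ..., m} is 'I_m. *)

Definition ones {R : realType} {m : nat} : 'cV[R]_m := const_mx 1.

Definition stochastic (R : realType) (m : nat) (P : 'M[R]_m) : Prop :=
  (forall i j, 0 <= P i j) /\ P *m ones = ones.

Definition irreducible (R : realType) (m : nat) (P : 'M[R]_m) : Prop :=
  forall i j, exists n : nat, 0 < (P ^+ n) i j.

Definition stationary (R : realType) (m : nat) (P : 'M[R]_m) (pi : 'rV[R]_m)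
    : Prop :=
  [/\ forall j, 0 <= pi 0 j, pi *m P = pi & pi *m ones = 1%:M].

(* The Markov property is multiplied out, so that histories of probability 0
   impose nothing:
   Pr(X_0 = x_0, ..., X_{n+1} = x_{n+1})
     = Pr(X_0 = x_0, ..., X_n = x_n) P(x_n, x_{n+1}). *)
Definition markov_chain (R : realType) (d : measure_display)
    (T : measurableType d) (Pr : probability T R) (m : nat) (P : 'M[R]_m)
    (X : nat -> T -> 'I_m) : Prop :=
  (forall n j, measurable [set w | X n w = j]) /\
  (forall (x : nat -> 'I_m) (n : nat),
     Pr [set w | forall k, (k <= n.+1)%N -> X k w = x k] =
     (Pr [set w | forall k, (k <= n)%N -> X k w = x k]
        * (P (x n) (x n.+1))%:E)%E).

(* min {n >= 1 : X_n = j}, equal to +oo when X never visits j after time 0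
   (the infimum of the empty set in \bar R is +oo). *)
Definition passage_time (R : realType) (T : Type) (m : nat)
    (X : nat -> T -> 'I_m) (j : 'I_m) (w : T) : \bar R :=
  ereal_inf [set n%:R%:E | n in [set n | (1 <= n)%N /\ X n w = j]].

(* Elementary conditional expectation given an event B with Pr B > 0. *)
Definition cond_expectation (R : realType) (d : measure_display)
    (T : measurableType d) (Pr : probability T R) (f : T -> \bar R)
    (B : set T) : \bar R :=
  ((\int[Pr]_(w in B) f w) / Pr B)%E.

Definition mean_passage (R : realType) (d : measure_display)
    (T : measurableType d) (Pr : probability T R) (m : nat)
    (X : nat -> T -> 'I_m) (i j : 'I_m) : \bar R :=
  cond_expectation Pr (passage_time R X j) [set w | X 0%N w = i].

Definition is_group_inverse (R : realType) (m : nat) (A X : 'M[R]_m) : Prop :=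
  [/\ A *m X *m A = A, X *m A *m X = X & A *m X = X *m A].

Lemma group_inverse_unique (R : realType) (m : nat) (A X Y : 'M[R]_m) :
  is_group_inverse A X -> is_group_inverse A Y -> X = Y.
Proof.
move=> [AXA XAX AX] [AYA YAY AY].
have E : A *m X = A *m Y.
  by rewrite AX -[in LHS]AYA -!mulmxA mulmxA mulmxA -AX -!mulmxA -[in LHS]AY
    !mulmxA AXA.
by rewrite -XAX -mulmxA E mulmxA -AX E AY YAY.
Qed.

(* Main.v *)
(* Fix a target state j. Since T_j is the sum over n >= 0 of the indicators of
   {X_1, ..., X_n <> j}, the Markov property gives m_{.j} = sum_n Q^n e, where Q
   is P with column j set to 0; hence m_{.j} = e + Q m_{.j}. The series is
   finite at j because pi_j (Q^n e)_j = pi Q^n e - pi Q^{n+1} e telescopes, and then at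
   every state by irreducibility. Consequently the matrix W with entries
   pi_j m_{ij} - delta_{ij}, which vanishes on the diagonal, satisfies
   (I - P) W = e pi - I, and so e (pi W) - W is killed by pi on the left and
   inverts I - P modulo e pi: it is the group inverse. *)

Require Import Defs.
From HB Require Import structures.
From mathcomp Require Import all_boot all_order all_algebra.
From mathcomp Require Import all_classical all_reals all_analysis.
From mathcomp Require Import zify.

Set Implicit Arguments.
Unset Strict Implicit.
Unset Printing Implicit Defensive.

Import Order.TTheory GRing.Theory Num.Theory.
Import numFieldNormedType.Exports.

Local Open Scope classical_set_scope.
Local Open Scope ring_scope.

(** * Linear algebra: the group inverse from a solution of [(1%:M - P) *m W = ones *m pi - 1%:M] *)

(** Subtracting [W] from [ones *m (pi *m W)] forces [pi *m G = 0] and leaves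
    [(1%:M - P) *m G = 1%:M - ones *m pi], so [G + ones *m pi] is a right inverse of the square
    matrix [M]. Being two-sided, it also yields the product in the other order. *)
Lemma deviation_inverse (R : realType) (m : nat) (P W : 'M[R]_m)
    (pi : 'rV[R]_m) :
  stochastic P -> stationary P pi -> (1%:M - P) *m W = ones *m pi - 1%:M ->
  let M := 1%:M - P + ones *m pi in
  let G := ones *m (pi *m W) - W in
  [/\ M \in unitmx, invmx M - ones *m pi = G & is_group_inverse (1%:M - P) G].
Proof.
move=> [_ Pe] [_ piP pie] AW M G.
have Ae : (1%:M - P) *m ones = 0 :> 'cV_m by rewrite mulmxBl mul1mx Pe subrr.
have piA : pi *m (1%:M - P) = 0 by rewrite mulmxBr mulmx1 piP subrr.
have AG : (1%:M - P) *m G = 1%:M - ones *m pi.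
  by rewrite /G mulmxBr (mulmxA _ ones) Ae mul0mx AW sub0r opprB.
have piG : pi *m G = 0 by rewrite /G mulmxBr (mulmxA pi) pie mul1mx subrr.
have Me : M *m ones = ones by rewrite mulmxDl Ae add0r -mulmxA pie mulmx1.
have MG : M *m (G + ones *m pi) = 1%:M.
  rewrite mulmxDr (mulmxA M) Me mulmxDl AG -(mulmxA _ pi) piG mulmx0 addr0.
  by rewrite subrK.
have Mu : M \in unitmx by have /mulmx1_unit[] := MG.
have iM : invmx M = G + ones *m pi.
  by rewrite -[LHS]mulmx1 -MG mulmxA mulVmx // mul1mx.
have GA : G *m (1%:M - P) = 1%:M - ones *m pi.
  (* Since [M] fixes [ones], so does its inverse. *)
  have Ge : G *m ones = 0 :> 'cV_m.
    have -> : G = invmx M - ones *m pi by rewrite iM addrK.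
    rewrite mulmxBl -[in X in X - _]Me mulKmx // -mulmxA pie mulmx1.
    by rewrite subrr.
  have : (G + ones *m pi) *m M = 1%:M by rewrite -iM mulVmx.
  rewrite mulmxDl {1}/M (mulmxDr G) (mulmxA G) Ge mul0mx addr0.
  rewrite -(mulmxA _ pi) /M (mulmxDr pi) piA add0r (mulmxA pi) pie mul1mx => E.
  by rewrite -[LHS](addrK (ones *m pi)) E.
split=> //; first by rewrite iM addrK.
split.
- by rewrite AG mulmxBl mul1mx -mulmxA piA mulmx0 subr0.
- by rewrite GA mulmxBl mul1mx -mulmxA piG mulmx0 subr0.
- by rewrite AG GA.
Qed.

(** * Survival probabilities off a target state and the convergence of their series *)

Definition taboo (R : realType) (m : nat) (P : 'M[R]_m) (j : 'I_m) : 'M[R]_m :=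
  \matrix_(i, k) if k == j then 0 else P i k.

(* Entry [i] is Pr(X_1 <> j, ..., X_n <> j | X_0 = i). *)
Definition survival (R : realType) (m : nat) (P : 'M[R]_m) (j : 'I_m)
    (n : nat) : 'cV[R]_m := taboo P j ^+ n *m ones.

Lemma survivalS (R : realType) (m : nat) (P : 'M[R]_m) (j : 'I_m) (n : nat) :
  survival P j n.+1 = taboo P j *m survival P j n.
Proof. by rewrite /survival exprS -mulmxA. Qed.

Lemma survival0 (R : realType) (m : nat) (P : 'M[R]_m) (j : 'I_m) :
  survival P j 0 = ones.
Proof. by rewrite /survival expr0 mul1mx. Qed.

Lemma survival_ge0 (R : realType) (m : nat) (P : 'M[R]_m) (j i : 'I_m) n :
  (forall i j, 0 <= P i j) -> 0 <= survival P j n i 0.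
Proof.
move=> P0; elim: n i => [|n IH] i; first by rewrite survival0 mxE.
rewrite survivalS mxE sumr_ge0 // => k _; rewrite mulr_ge0 // mxE.
by case: ifP.
Qed.

Lemma tabooE (R : realType) (m : nat) (P : 'M[R]_m) (j : 'I_m) :
  taboo P j = P - col j P *m delta_mx 0 j.
Proof.
apply/matrixP => i k; rewrite !mxE big_ord1 !mxE eqxx /=.
by case: eqP => [->|_]; rewrite ?mulr1 ?subrr ?mulr0 ?subr0.
Qed.

Lemma taboo_mul (R : realType) (m : nat) (P : 'M[R]_m) (j : 'I_m)
    (v : 'cV[R]_m) :
  taboo P j *m v = P *m v - v j 0 *: col j P.
Proof.
rewrite tabooE mulmxBl -mulmxA; congr (_ - _).
rewrite -rowE; apply/matrixP => i k; rewrite !mxE big_ord1 !mxE mulrC.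
by rewrite (ord1 k).
Qed.

Lemma expmx_ge0 (R : realType) (m : nat) (P : 'M[R]_m) :
  (forall i j, 0 <= P i j) -> forall n i j, 0 <= (P ^+ n) i j.
Proof.
move=> P0; elim=> [|n IH] i j; first by rewrite expr0 mxE ler0n.
by rewrite exprS mxE sumr_ge0 // => l _; rewrite mulr_ge0.
Qed.

(** Some entry of [pi] is positive because they sum to 1; invariance under every power of [P] and
    irreducibility carry positivity to [j]. *)
Lemma stationary_pos (R : realType) (m : nat) (P : 'M[R]_m) (pi : 'rV[R]_m)
    (j : 'I_m) :
  stochastic P -> irreducible P -> stationary P pi -> 0 < pi 0 j.
Proof.
move=> [P0 _] Pirr [pi0 piP pie].
have P0n := expmx_ge0 P0.
have piPn n : pi *m P ^+ n = pi.
  by elim: n => [|n IH]; rewrite ?mulmx1 // exprS mulmxA piP.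
have [i pii] : exists i, 0 < pi 0 i.
  apply/existsP; apply: contraT; rewrite negb_exists => /forallP H.
  have : (pi *m ones) 0 0 = 0.
    rewrite !mxE big1 // => k _.
    by have := H k; rewrite lt_def pi0 andbT negbK => /eqP ->; rewrite mul0r.
  by rewrite pie mxE eqxx => /eqP; rewrite oner_eq0.
have [n Pn] := Pirr i j.
rewrite -(piPn n) mxE (bigD1 i) //= ltr_pwDl ?mulr_gt0 //.
by rewrite sumr_ge0 // => k _; rewrite mulr_ge0.
Qed.

Lemma survival_series_bounded (R : realType) (m : nat) (P : 'M[R]_m)
    (pi : 'rV[R]_m) (j i : 'I_m) :
  stochastic P -> irreducible P -> stationary P pi ->
  exists C, forall N, \sum_(0 <= n < N) survival P j n i 0 <= C.
Proof.
move=> Pst Pirr pist; have pij := stationary_pos j Pst Pirr pist.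
case: (Pst) => P0 _; case: (pist) => pi0 piP pie.
have s0 := survival_ge0.
have P0n := expmx_ge0 P0.
(* The [pi]-mass lost at step [n] is [pi_j survival_n(j)]. *)
have bndj : exists C, forall N, \sum_(0 <= n < N) survival P j n j 0 <= C.
  exists (pi 0 j)^-1 => N.
  have E n : pi 0 j * survival P j n j 0 =
      (pi *m survival P j n) 0 0 - (pi *m survival P j n.+1) 0 0.
    rewrite survivalS taboo_mul mulmxBr (mulmxA pi P) piP -scalemxAr.
    have -> : pi *m col j P = col j pi by rewrite !colE mulmxA piP.
    by rewrite !mxE opprB addrC subrK mulrC.
  rewrite -(ler_pM2l pij) mulfV ?gt_eqF // mulr_sumr.
  under eq_bigr do rewrite E.
  rewrite -[leLHS]opprK -sumrN; under eq_bigr do rewrite opprB.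
  rewrite (telescope_sumr (fun n => (pi *m survival P j n) 0 0)) //.
  (* The telescoped sum starts at [pi *m ones], which is 1, and its subtracted end is
     nonnegative. *)
  rewrite opprB survival0 pie [X in X - _]mxE eqxx lerBlDr lerDl.
  by rewrite mxE sumr_ge0 // => k _; rewrite mulr_ge0 // s0.
(* First-step analysis carries the bound from [j] along each edge, hence to
   every state reachable from [j]. *)
have [n Pn] := Pirr j i.
elim: n i Pn => [|n IH] i.
  by rewrite expr0 mxE; case: eqP => [<- //|]; rewrite ltxx.
(* For [i <> j] the edge from [k] to [i] keeps its weight [P k i] in [taboo P j]. *)
case: (eqVneq i j) => [-> //|ij].
rewrite exprSr mxE => Pn.
have [k /andP[jk ki]] : exists k, (0 < (P ^+ n) j k) && (0 < P k i).
  apply/existsP; apply: contraTT Pn; rewrite negb_exists => /forallP H.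
  rewrite -leNgt sumr_le0 // => k _; have := H k.
  by rewrite !lt_def P0 P0n !andbT negb_and !negbK => /orP[]/eqP->;
    rewrite ?mul0r ?mulr0.
have [C HC] := IH k jk.
(* One more term is taken at [k], since a step is spent on the edge to [i]; the term of index 0 at
   [k] is dropped. *)
exists (C / P k i) => N; rewrite ler_pdivlMr //; apply: le_trans (HC N.+1).
rewrite big_nat_recl //= mulr_suml -[leLHS]add0r lerD ?s0 // ler_sum // => l _.
rewrite survivalS [leRHS]mxE (bigD1 i) //= [taboo P j k i]mxE.
rewrite (negbTE ij) mulrC lerDl.
by rewrite sumr_ge0 // => q _; rewrite mulr_ge0 ?s0 // mxE; case: ifP.
Qed.

Lemma survival_series_cvg (R : realType) (m : nat) (P : 'M[R]_m)
    (pi : 'rV[R]_m) (j : 'I_m) :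
  stochastic P -> irreducible P -> stationary P pi ->
  exists2 v : 'cV[R]_m, v = ones + taboo P j *m v &
    forall i, series (fun n => survival P j n i 0) @ \oo --> v i 0.
Proof.
move=> Pst Pirr pist; case: (Pst) => P0 _.
have cv i : cvgn (series (fun n => survival P j n i 0)).
  have [C HC] := survival_series_bounded j i Pst Pirr pist.
  apply: nondecreasing_is_cvgn.
    by apply: nondecreasing_series => n _ _; exact: survival_ge0.
  by exists C => _ [n _ <-]; exact: HC.
pose v : 'cV[R]_m := \col_i limn (series (fun n => survival P j n i 0)).
have vl i : series (fun n => survival P j n i 0) @ \oo --> v i 0.
  by rewrite mxE; exact: cv.
exists v => //; apply/matrixP => i k; rewrite (ord1 k) {k}.
(* The shifted partial sums keep the limit, and they equal 1 plus [taboo P j] applied to the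
   unshifted ones; uniqueness of limits gives the fixed-point equation. *)
have := vl i; rewrite -cvg_shiftS => vSi.
apply: (cvg_unique (@Rhausdorff R) vSi).
rewrite !mxE.
have -> : [sequence series (fun n => survival P j n i 0) n.+1]_n =
   (fun N => 1 + \sum_k taboo P j i k * series (fun n => survival P j n k 0) N).
  apply/funext => N; rewrite /= /series /= big_nat_recl // survival0 mxE.
  congr (_ + _); under eq_bigr do rewrite survivalS mxE.
  by rewrite exchange_big; apply: eq_bigr => k _; rewrite mulr_sumr.
apply: cvgD; first exact: cvg_cst.
apply: cvg_big; first exact: add_continuous.
by move=> k _; apply: cvgMr; exact: vl.
Qed.

(** * From the law of the chain to mean passage times *)

Lemma measurable_cylinder (R : realType) (d : measure_display)
    (T : measurableType d) (m : nat) (X : nat -> T -> 'I_m)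
    (A : nat -> set 'I_m) :
  (forall n j, measurable [set w | X n w = j]) ->
  measurable [set w | forall k, A k (X k w)].
Proof.
move=> mX.
have -> : [set w | forall k, A k (X k w)] =
    \bigcap_k \bigcup_(a in A k) [set w | X k w = a].
  apply/seteqP; split=> w /=.
    by move=> H k _; exists (X k w) => //=; exact: H.
  by move=> H k; have [a Aa /= ->] := H k Logic.I.
apply: bigcapT_measurable => k; exact: fin_bigcup_measurable.
Qed.

(** The history is arbitrary because the induction on [r] lengthens it by one state at a time; the
    passage times need only [n = 0]. *)
Lemma markov_avoid (R : realType) (d : measure_display) (T : measurableType d)
    (Pr : probability T R) (m : nat) (P : 'M[R]_m) (X : nat -> T -> 'I_m)
    (j : 'I_m) (r n : nat) (x : nat -> 'I_m) :
  markov_chain Pr P X ->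
  Pr [set w | (forall k, (k <= n)%N -> X k w = x k) /\
              (forall k, (n < k <= n + r)%N -> X k w <> j)] =
  (Pr [set w | forall k, (k <= n)%N -> X k w = x k]
     * (survival P j r (x n) 0)%:E)%E.
Proof.
move=> [mX mk].
(* Split on the value [l] of X_{n+1} and extend the history [x] by [l]. *)
elim: r n x => [|r IH] n x.
  rewrite survival0 mxE mule1; congr (Pr _).
  apply/seteqP; split=> w /=; first by case.
  by move=> H; split=> // k; rewrite addn0 ltnNge => /andP[/negP].
pose y l := fun k => if k == n.+1 then l else x k.
pose E l := [set w | (forall k, (k <= n.+1)%N -> X k w = y l k) /\
              (forall k, (n.+1 < k <= n.+1 + r)%N -> X k w <> j)].
(* The empty piece at [l = j] matches the zeroed column of [taboo P j], so one formula gives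
   [Pr (F l)] for all [l]. *)
pose F l := if l == j then set0 else E l.
have -> : [set w | (forall k, (k <= n)%N -> X k w = x k) /\
              (forall k, (n < k <= n + r.+1)%N -> X k w <> j)] =
    \big[setU/set0]_(l < m) F l.
  rewrite -bigcup_seq; apply/seteqP; split=> w /=.
    move=> [Hx Hj]; exists (X n.+1 w); first by rewrite /= mem_index_enum.
    rewrite /F; case: eqP => [/Hj|_].
      by rewrite ltnSn addnS ltnS leq_addr => /(_ isT).
    split=> k kn; last by apply: Hj; move: kn; lia.
    rewrite /y; case: eqP => [->//|kN]; apply: Hx.
    by move: kn; rewrite leq_eqVlt => /orP[/eqP //|].
  move=> [l _]; rewrite /F; case: eqP => //= lj [Hx Hj]; split=> k kn.
    rewrite Hx ?(leq_trans kn) // /y; case: eqP => // kN.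
    by move: kn; rewrite kN ltnn.
  case: (eqVneq k n.+1) => [->|kN]; first by rewrite Hx // /y eqxx.
  by apply: Hj; move: kn kN; lia.
have mE l : measurable (E l).
  have := @measurable_cylinder R d T m X (fun k a =>
    ((k <= n.+1)%N -> a = y l k) /\ ((n.+1 < k <= n.+1 + r)%N -> a <> j)) mX.
  congr (measurable _); apply/seteqP; split=> w /=.
    by move=> H; split=> k; have [] := H k.
  by move=> [H1 H2] k; split; [exact: H1|exact: H2].
have mF l : measurable (F l) by rewrite /F; case: ifP.
rewrite measure_semi_additive_ord //; last 2 first.
- apply/trivIsetP => a b _ _ ab; rewrite /F.
  case: eqP => _; first by rewrite set0I.
  case: eqP => _; first by rewrite setI0.
  rewrite -subset0 => w /= [[Ha _] [Hb _]]; apply: (negP ab); apply/eqP.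
  have := Ha n.+1 (leqnn _); rewrite (Hb n.+1 (leqnn _)) /y eqxx.
  by move->.
- exact: bigsetU_measurable.
set H := [set w | forall k, (k <= n)%N -> X k w = x k].
have PrF l : Pr (F l) =
    (Pr H * (taboo P j (x n) l * survival P j r l 0)%:E)%E.
  rewrite /F mxE; case: eqP => [_|_]; first by rewrite measure0 mul0r mule0.
  rewrite /E IH mk EFinM muleA /y eqxx; congr (Pr _ * (P _ _)%:E * _)%E.
    apply/seteqP; split=> w /= Hw k kn; have := Hw k kn;
    by case: eqP kn => // ->; rewrite ltnn.
  by rewrite ltn_eqF.
rewrite (eq_bigr _ (fun l _ => PrF l)).
have mH : measurable H.
  exact: (@measurable_cylinder R d T m X
    (fun k a => (k <= n)%N -> a = x k) mX).
rewrite survivalS mxE -(fineK (fin_num_measure Pr H mH)) -EFinM mulr_sumr.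
by rewrite -sumEFin; apply: eq_bigr => l _; rewrite EFinM.
Qed.

(** The indicator of index [n] is 1 exactly when [n] is below the passage time; at [n = 0] its
    condition is vacuous. *)
Lemma passage_time_series (R : realType) (T : Type) (m : nat)
    (X : nat -> T -> 'I_m) (j : 'I_m) (w : T) :
  passage_time R X j w = (\sum_(0 <= n <oo)
    (\1_[set w | forall k, (0 < k <= n)%N -> X k w <> j] w)%:E)%E.
Proof.
rewrite /passage_time.
case: (pselect (exists n, (0 < n)%N && (X n w == j))) => [ex|nex].
  case: (ex_minnP ex) => N /andP[N0 /eqP XN] Nmin.
  rewrite (nneseries_split 0 N) //.
  rewrite [X in (_ + X)%E]eseries0 ?adde0.
    rewrite big_mkord (eq_bigr (fun=> 1%E)) => [|k _].
      rewrite sumEFin sumr_const card_ord.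
      apply/eqP; rewrite eq_le; apply/andP; split.
        by apply: ereal_inf_lbound; exists N.
      apply: le_ereal_inf_tmp => _ [n /= [n0 Xn] <-].
      by rewrite lee_fin ler_nat Nmin // n0 Xn eqxx.
    rewrite indicE mem_set //= => q /andP[q0 qk] Xq.
    have := Nmin q; rewrite q0 Xq eqxx => /(_ isT).
    by rewrite leqNgt (leq_ltn_trans qk) //.
  move=> n Nn _; rewrite indicE memNset //= => /(_ N).
  by rewrite N0 -[N]add0n; apply.
rewrite (_ : [set _ | n in _] = set0); last first.
  rewrite -subset0 => _ [n /= [n0 Xn] _]; apply: nex; exists n.
  by rewrite n0 Xn eqxx.
rewrite ereal_inf0; apply/esym/eq_infty => t.
(* When [j] is never visited all terms are 1, so this many of them already exceed [t]. *)
apply: le_trans (nneseries_lim_ge (Num.truncn t).+1 _) => //.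
rewrite big_mkord (eq_bigr (fun=> 1%E)) => [|k _].
  by rewrite sumEFin sumr_const card_ord lee_fin ltW // truncnS_gt.
rewrite indicE mem_set //= => q /andP[q0 _] Xq.
by apply: nex; exists q; rewrite q0 Xq eqxx.
Qed.

(** Nonnegativity allows integrating the indicator series term by term; each term gives [Pr B] times
    a survival probability, and the positive finite factor [Pr B] cancels. *)
Lemma mean_passageE (R : realType) (d : measure_display) (T : measurableType d)
    (Pr : probability T R) (m : nat) (P : 'M[R]_m) (X : nat -> T -> 'I_m)
    (i j : 'I_m) (v : R) :
  markov_chain Pr P X -> (0 < Pr [set w | X 0%N w = i])%E ->
  (forall n, 0 <= survival P j n i 0) ->
  series (fun n => survival P j n i 0) @ \oo --> v ->
  mean_passage Pr X i j = v%:E.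
Proof.
move=> mk; case: (mk) => mX _ pos s0 cv.
rewrite /mean_passage /cond_expectation.
set B := [set w | _]; rewrite -/B in pos.
pose A n := [set w | forall k, (0 < k <= n)%N -> X k w <> j].
have mB : measurable B by exact: mX.
have mA n : measurable (A n).
  exact: (@measurable_cylinder R d T m X
    (fun k a => (0 < k <= n)%N -> a <> j) mX).
have PrAB n : Pr (A n `&` B) = (Pr B * (survival P j n i 0)%:E)%E.
  have := markov_avoid j n 0 (fun=> i) mk.
  have -> : [set w | forall k, (k <= 0)%N -> X k w = i] = B.
    apply/seteqP; split=> w /= H; first exact: H.
    by case.
  move=> <-; congr (Pr _); apply/seteqP; split=> w /= [H1 H2]; split=> //.
  - by case.
  - exact: H1.
have -> : (\int[Pr]_(w in B) passage_time R X j w)%E =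
    (Pr B * v%:E)%E.
  under eq_integral do rewrite passage_time_series.
  rewrite integral_nneseries //; last first.
    move=> n; apply/measurable_realfun.measurable_EFinP.
    by apply: measurable_realfun.measurable_indic; exact: mA.
  have intA n : (\int[Pr]_(w in B) (\1_(A n) w)%:E =
      Pr B * (survival P j n i 0)%:E)%E.
    exact: etrans (integral_indic Pr mB (mA n)) (PrAB n).
  rewrite (eq_eseriesr (fun n _ => intA n)).
  rewrite -(fineK (fin_num_measure Pr B mB)) nneseriesZl; last first.
    by move=> n _; rewrite lee_fin.
  congr (_ * _)%E; rewrite -(cvg_lim _ cv) // -EFin_lim; last first.
    by apply/cvg_ex; exists v.
  congr (limn _); apply/funext => n; rewrite /= /series /= -sumEFin //.
have Bfin := fin_num_measure Pr B mB.
rewrite muleAC divee ?mul1e // gt_eqF //.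
Qed.

(** * First-step equations and the entries of the group inverse *)

(** The first-step equation reads [(1%:M - P) *m v j = ones - v j j 0 *: col j P]. Applying [pi] on
    the left kills the left side and gives [pi 0 j * v j j 0 = 1]; with this, the two multiples of
    [col j P] in column [j] of [(1%:M - P) *m W] cancel. *)
Lemma mean_passage_deviation (R : realType) (m : nat) (P W : 'M[R]_m)
    (pi : 'rV[R]_m) (v : 'I_m -> 'cV[R]_m) :
  stationary P pi -> (forall j, v j = ones + taboo P j *m v j) ->
  W = \matrix_(i, j) (pi 0 j * v j i 0 - (i == j)%:R) ->
  (forall j, pi 0 j * v j j 0 = 1) /\ (1%:M - P) *m W = ones *m pi - 1%:M.
Proof.
move=> [_ piP pie] vE WE.
have Av j : (1%:M - P) *m v j = ones - v j j 0 *: col j P.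
  rewrite mulmxBl mul1mx {1}vE taboo_mul addrA.
  by rewrite addrAC addrK.
have pv j : pi 0 j * v j j 0 = 1.
  have : pi *m ((1%:M - P) *m v j) = 0.
    by rewrite mulmxA mulmxBr mulmx1 piP subrr mul0mx.
  rewrite Av mulmxBr pie -scalemxAr colE mulmxA piP -colE.
  move=> /matrixP /(_ 0 0); rewrite !mxE eqxx mulrC => /eqP.
  by rewrite subr_eq0 => /eqP <-.
split=> //; apply/matrixP => i j.
have colW : col j W = pi 0 j *: v j - delta_mx j 0.
  by apply/matrixP => k l; rewrite WE !mxE (ord1 l) eqxx andbT.
have -> : ((1%:M - P) *m W) i j = (col j ((1%:M - P) *m W)) i 0.
  by rewrite [in RHS]mxE.
rewrite colE -mulmxA -colE colW mulmxBr -scalemxAr Av scalerBr scalerA pv.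
rewrite scale1r mulmxBl mul1mx -colE opprB addrA subrK.
by rewrite !mxE big_ord1 !mxE eqxx andbT mulr1 mul1r.
Qed.

Theorem corollary11p7 (R : realType) (m : nat) (P : 'M[R]_m) (pi : 'rV[R]_m)
    (d : measure_display) (T : measurableType d) (Pr : probability T R)
    (X : nat -> T -> 'I_m)
    (P_stochastic : stochastic P)
    (P_irreducible : irreducible P)
    (pi_stationary : stationary P pi)
    (X_markov : markov_chain Pr P X)
    (X0_pos : forall i, (0 < Pr [set w | X 0%N w = i])%E) :
  let M := 1%:M - P + ones *m pi in
  let Ag := invmx M - ones *m pi in
  let mfp := mean_passage Pr X in
  let tau := fun j => (\sum_(k < m) (pi 0 k)%:E * mfp k j)%E in
  [/\ M \in unitmx,
      is_group_inverse (1%:M - P) Ag &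
      forall i j,
        (Ag i j)%:E =
        (if i != j then (pi 0 j)%:E * (tau j - 1 - mfp i j)
         else (pi 0 j)%:E * (tau j - 1))%E].
Proof.
move=> M Ag mfp tau.
have /choice[v vP] : forall j, exists v : 'cV[R]_m, v = ones + taboo P j *m v /\
    forall i, series (fun n => survival P j n i 0) @ \oo --> v i 0.
  move=> j.
  by have [v ? ?] := survival_series_cvg j P_stochastic P_irreducible
    pi_stationary; exists v.
have mfpE i j : mfp i j = (v j i 0)%:E.
  apply: (mean_passageE X_markov) => //; last exact: (vP j).2.
  by move=> n; apply: survival_ge0; exact: P_stochastic.1.
have [pv AW] := mean_passage_deviation pi_stationary (fun j => (vP j).1) erefl.
have [Mu AgE Agi] := deviation_inverse P_stochastic pi_stationary AW.
split=> //; first by rewrite /Ag /M AgE.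
move=> i j; rewrite /Ag /M AgE.
have -> : tau j = (\sum_(k < m) pi 0 k * v j k 0)%:E.
  by rewrite /tau -sumEFin; apply: eq_bigr => k _; rewrite mfpE EFinM.
rewrite mfpE -!EFinB -!EFinM.
(* The Kronecker delta in [W] contributes the single term [pi 0 j], the source of the [- 1] beside
   [tau j]. *)
have piW : (pi *m \matrix_(k, l) (pi 0 l * v l k 0 - (k == l)%:R)) 0 j =
    pi 0 j * (\sum_(k < m) pi 0 k * v j k 0 - 1).
  rewrite mxE; under eq_bigr do rewrite mxE mulrBr.
  rewrite sumrB mulrBr mulr1 mulr_sumr; congr (_ - _).
    by apply: eq_bigr => k _; rewrite mulrCA.
  rewrite (bigD1 j) //= eqxx mulr1 big1 ?addr0 // => k /negbTE ->.
  by rewrite mulr0.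
rewrite mxE [X in X + _]mxE big_ord1 piW !mxE mul1r.
(* On the diagonal [pv] makes the entry of [W] vanish, so no passage time remains there. *)
case: eqVneq => [->|_] /=; first by rewrite pv subrr subr0.
by rewrite subr0 [in RHS]mulrBr.
Qed.
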